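(* Let $F$ be a non-abelian free group of finite rank and let $\alpha:F\to\mathbb{R}$ be an alternating map supported on the set $\mathcal N$ of non-self-overlapping words. Put $\varphi_\alpha:=\sum_{w\in\mathcal N^+}\alpha_wh_w$ and $\tilde\varphi_\alpha:=\sum_{w\in\mathcal N^+}\alpha_w\overline{h_w}$. Suppose that $\varphi_\alpha$ is a quasimorphism. Then $\tilde\varphi_\alpha$ is also a quasimorphism, and the homogenization of $\varphi_\alpha$ is $\overline{\varphi_\alpha}=\tilde\varphi_\alpha$.
   Context: A quasimorphism is a map $\varphi:F\to\mathbb{R}$ with $\sup_{g,h}|\varphi(g)+\varphi(h)-\varphi(gh)|<\infty$. Its homogenization is $\overline\varphi(g)=\lim_{n\to\infty}\varphi(g^n)/n$. $F$ has a fixed basis; elements are reduced words; a product is reduced if there is no cancellation. $w$ is a subword of $g$ if $g=uwv$ as a reduced product. A word $w$ is self-overlapping if $w=xy=yz$ as reduced products for some $x,y,z\ne1$; $\mathcal N$ is the set of non-self-overlapping words. $\mathcal N^+\subset\mathcal N$ contains precisely one of $w,w^{-1}$ for each $1\ne w\in\mathcal N$ (and not $1$). The map $\alpha$ is alternating if $\alpha_{w^{-1}}=-\alpha_w$. For $w\in\mathcal N$, $w\ne 1$, $h_w(g)$ is the number of occurrences of $w$ as a subword of $g$ minus the number of occurrences of $w^{-1}$; this is a quasimorphism. Both sums are finite at each $g\in F$: $h_w(g)=\overline{h_w}(g)=0$ if $|w|>|g|$. They do not depend on the choice of $\mathcal N^+$. *)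

(* Defs.v *)
From HB Require Import structures.
From mathcomp Require Import all_boot all_order all_algebra.
From mathcomp Require Import all_classical all_reals.
From mathcomp Require Import ring lra.
From mathcomp Require Import topology normedtype sequences.

Set Implicit Arguments.
Unset Strict Implicit.
Unset Printing Implicit Defensive.

Import Order.TTheory GRing.Theory Num.Theory.
Import numFieldNormedType.Exports.

Local Open Scope classical_set_scope.
Local Open Scope ring_scope.

Section FreeGroup.
Variable X : finType.

(* The letter (x, true) is the generator x, and (x, false) is its inverse. *)
Definition letter : finType := (X * bool)%type.
Implicit Types (a b : letter) (s t u : seq letter).

Definition linv a : letter := (a.1, ~~ a.2).

Definition reduced s : bool := sorted (fun a b => b != linv a) s.

Record freegroup := FreeGroup { word :> seq letter; _ : reduced word }.

HB.instance Definition _ := [isSub for word].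
HB.instance Definition _ := [Choice of freegroup by <:].

Implicit Types f g h : freegroup.

Definition lmul a s : seq letter :=
  if s is b :: s' then if b == linv a then s' else a :: s else [:: a].

Definition wmul s t : seq letter := foldr lmul t s.

Definition winv s : seq letter := rev (map linv s).

Lemma linvK : involutive linv.
Proof. by case=> x b; rewrite /linv /= negbK. Qed.

Lemma linv_neq a : linv a != a.
Proof. by case: a => x []; rewrite /linv xpair_eqE /= andbF. Qed.

Lemma wordP g : reduced g.
Proof. by case: g. Qed.

Lemma reduced_lmul a s : reduced s -> reduced (lmul a s).
Proof.
case: s => [|b s] //= pbs; case: ifP => [_|/negbT nba]; first exact: path_sorted pbs.
by rewrite /reduced /= nba.
Qed.

Lemma reduced_wmul s t : reduced t -> reduced (wmul s t).
Proof. by move=> rt; elim: s => //= a s IHs; exact: reduced_lmul. Qed.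

Lemma lmulK a s : reduced s -> lmul a (lmul (linv a) s) = s.
Proof.
case: s => [|b s] /= rs; first by rewrite eqxx.
rewrite linvK; case: eqVneq rs => [->|nba] rs /=; last by rewrite eqxx.
by case: s rs => [|c s] //= /andP[/negPf ->].
Qed.

Lemma wmul_lmul a s t : reduced t -> wmul (lmul a s) t = lmul a (wmul s t).
Proof.
case: s => [|b s] //= rt; case: eqVneq => [->|//].
by rewrite lmulK //; exact: reduced_wmul.
Qed.

Lemma wmulA s t u : reduced u -> wmul s (wmul t u) = wmul (wmul s t) u.
Proof. by move=> ru; elim: s => //= a s ->; rewrite wmul_lmul. Qed.

Lemma wmuls0 s : reduced s -> wmul s [::] = s.
Proof.
elim: s => //= a s IHs ras; rewrite IHs; last exact: path_sorted ras.
by case: s ras {IHs} => //= b s /andP[/negPf ->].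
Qed.

Lemma winvK : involutive winv.
Proof. by move=> s; rewrite /winv map_rev revK mapK //; exact: linvK. Qed.

Lemma reduced_winv s : reduced s -> reduced (winv s).
Proof.
rewrite /reduced /winv rev_sorted sorted_map; apply: sub_sorted => a b /=.
by apply: contraNN => /eqP ->; rewrite linvK.
Qed.

Lemma wmulKV s t : reduced t -> wmul s (wmul (winv s) t) = t.
Proof.
elim: s t => //= a s IHs t rt.
rewrite /winv map_cons rev_cons /wmul foldr_rcons -!/(wmul _ _).
by rewrite IHs ?lmulK //; exact: reduced_lmul.
Qed.

Lemma wmulsV s : reduced s -> wmul s (winv s) = [::].
Proof. by move=> rs; rewrite -(wmuls0 (reduced_winv rs)) wmulKV. Qed.

Definition fgone : freegroup := @FreeGroup [::] isT.
Definition fginv g : freegroup := FreeGroup (reduced_winv (wordP g)).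
Definition fgmul g h : freegroup := FreeGroup (reduced_wmul g (wordP h)).

Lemma fgmulA : associative fgmul.
Proof. by move=> f g h; apply: val_inj; rewrite /= wmulA //; exact: wordP. Qed.

Lemma fgmul1g : left_id fgone fgmul.
Proof. by move=> g; exact: val_inj. Qed.

Lemma fgmulg1 : right_id fgone fgmul.
Proof. by move=> g; apply: val_inj; rewrite /= wmuls0 //; exact: wordP. Qed.

Lemma fgmulgV : right_inverse fgone fginv fgmul.
Proof. by move=> g; apply: val_inj; rewrite /= wmulsV //; exact: wordP. Qed.

Lemma fgmulVg : left_inverse fgone fginv fgmul.
Proof.
move=> g; have {2}-> : g = fginv (fginv g) by apply: val_inj; rewrite /= winvK.
exact: fgmulgV.
Qed.

HB.instance Definition _ :=
  isGroup.Build freegroup fgmulA fgmul1g fgmulg1 fgmulVg fgmulgV.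

(* The product g * h has no cancellation. *)
Definition reduced_prod g h : Prop := word (g * h)%g = word g ++ word h.

Definition self_overlapping w : Prop :=
  exists x y z : freegroup,
    [/\ [/\ x <> 1%g, y <> 1%g & z <> 1%g],
        reduced_prod x y /\ reduced_prod y z,
        w = (x * y)%g & w = (y * z)%g].

Definition non_self_overlapping : set freegroup :=
  [set w | ~ self_overlapping w].

(* Np is a possible choice of the set N^+. *)
Definition positive_half (Np : set freegroup) : Prop :=
  [/\ Np `<=` non_self_overlapping, ~ Np 1%g &
      forall w, non_self_overlapping w -> w <> 1%g ->
        (Np w /\ ~ Np w^-1%g) \/ (~ Np w /\ Np w^-1%g)].

(* Counts the (possibly overlapping) occurrences of w in g: the reduced
   factorisations g = u * w * v are indexed by i = size u. *)
Definition occ (w g : freegroup) : nat :=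
  count (fun i => prefix w (drop i g)) (iota 0 (size g).+1).

End FreeGroup.

Section Quasimorphism.
Variables (R : realType) (G : groupType).
Implicit Types phi : G -> R.

Definition quasimorphism phi : Prop :=
  exists D : R, forall g h, `|phi g + phi h - phi (g * h)%g| <= D.

Definition homogenization phi (g : G) : R :=
  limn (fun n => phi (g ^+ n)%g / n%:R).

Lemma quasimorphism_expg phi D g m n :
    (forall g h, `|phi g + phi h - phi (g * h)%g| <= D) ->
  `|phi (g ^+ (m * n.+1))%g - n.+1%:R * phi (g ^+ m)%g| <= n.+1%:R * D.
Proof.
move=> hD; elim: n => [|n IHn].
  rewrite muln1 mul1r subrr normr0 mul1r.
  exact: le_trans (normr_ge0 _) (hD 1%g 1%g).
rewrite (mulnS m n.+1) expgnDr (mulrSr 1 n.+1) !mulrDl !mul1r.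
set p := phi _; set q := n.+1%:R * _.
have -> : p - (q + phi (g ^+ m)%g) =
    (phi (g ^+ (m * n.+1))%g - q) -
    (phi (g ^+ m)%g + phi (g ^+ (m * n.+1))%g - p).
  by rewrite opprB addrACA; ring.
by rewrite (le_trans (ler_normB _ _)) // lerD.
Qed.

(* So the limit in [homogenization] is a genuine one for quasimorphisms. *)
Lemma is_cvg_homogenization phi g : quasimorphism phi ->
  cvgn (fun n => phi (g ^+ n)%g / n%:R).
Proof.
move=> [D hD].
have D0 : 0 <= D by exact: le_trans (normr_ge0 _) (hD 1%g 1%g).
have H m n : `|phi (g ^+ (m.+1 * n.+1))%g / (m.+1 * n.+1)%:R -
               phi (g ^+ m.+1)%g / m.+1%:R| <= D / m.+1%:R.
  have /= := quasimorphism_expg g m.+1 n hD.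
  set p := phi _; set q := phi _ => pq.
  have mn0 : 0 < (m.+1 * n.+1)%:R :> R by rewrite ltr0n muln_gt0.
  have nM : 1 + m%:R != 0 :> R by rewrite -mulrS pnatr_eq0.
  have nN : 1 + n%:R != 0 :> R by rewrite -mulrS pnatr_eq0.
  have -> : p / (m.+1 * n.+1)%:R - q / m.+1%:R =
      (p - n.+1%:R * q) / (m.+1 * n.+1)%:R.
    by rewrite natrM; field; rewrite nN nM.
  rewrite normrM normfV (gtr0_norm mn0) ler_pdivrMr //.
  have -> // : D / m.+1%:R * (m.+1 * n.+1)%:R = n.+1%:R * D.
  by rewrite natrM; field; rewrite nM.
have H2 m n : `|phi (g ^+ m.+1)%g / m.+1%:R - phi (g ^+ n.+1)%g / n.+1%:R|
    <= D / m.+1%:R + D / n.+1%:R.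
  have := H m n; rewrite distrC => Hmn; have := H n m; rewrite mulnC => Hnm.
  exact: le_trans (ler_distD _ _ _) (lerD Hmn Hnm).
apply/cauchy_cvgP/cauchy_exP => e e0 /=.
have [N _ HN] : \forall n \near \oo, 2 * D / e < n%:R by exact: nbhs_infty_gtr.
have HD n : (N <= n)%N -> D / n.+1%:R < e / 2.
  move=> Nn; rewrite ltr_pdivrMr ?ltr0n //.
  have := HN n.+1 (leqW Nn); rewrite /= ltr_pdivrMr //; lra.
exists (phi (g ^+ N.+1)%g / N.+1%:R); exists N.+1 => // -[//|n] /= Nn.
apply: le_lt_trans (H2 N n) _.
by rewrite [ltRHS]splitr ltrD // HD.
Qed.

End Quasimorphism.

Section Counting.
Variables (R : realType) (X : finType).
Local Notation F := (freegroup X).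

Definition alternating (alpha : F -> R) : Prop :=
  forall w, alpha (w^-1)%g = - alpha w.

Definition supported_on (A : set F) (alpha : F -> R) : Prop :=
  forall w, alpha w <> 0 -> A w.

Definition counting_qm (w g : F) : R := (occ w g)%:R - (occ w^-1%g g)%:R.

(* The two sums are sums over the finite support of the summand, which
   vanishes whenever size w > size g and w is in N^+. *)
Definition phi_sum (Np : set F) (alpha : F -> R) (g : F) : R :=
  \sum_(w \in Np) alpha w * counting_qm w g.

Definition phi_tilde (Np : set F) (alpha : F -> R) (g : F) : R :=
  \sum_(w \in Np) alpha w * homogenization (counting_qm w) g.

End Counting.

(* Main.v *)
(* Write g = p c p^-1 with c cyclically reduced. A word w longer than c that
   occurs in some c^n has period |c|, hence is self-overlapping; so for w in N
   only the cyclic occurrences of w in c contribute to powers, and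
   h_w(c^(n+1)) = n C_w(c) + h_w(c) holds exactly, where C_w(c) is the cyclic
   version of h_w(c). As all terms with |w| > |c| vanish, summing over w gives
   phi_alpha(c^(n+1)) = n sum_w alpha_w C_w(c) + phi_alpha(c). Conjugation by p
   changes h_w and the quasimorphism phi_alpha by a bounded amount on the powers
   of c, so C_w(c) is the homogenization of h_w at g and sum_w alpha_w C_w(c) is
   that of phi_alpha. Finally, a homogenization is at bounded distance from its
   quasimorphism, hence is itself a quasimorphism. *)
Require Import Defs.
From HB Require Import structures.
From mathcomp Require Import all_boot all_order all_algebra.
From mathcomp Require Import all_classical all_reals.
From mathcomp Require Import ring lra zify.
From mathcomp Require Import topology normedtype sequences.

Import Order.TTheory GRing.Theory Num.Theory.
Import numFieldNormedType.Exports.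

Local Open Scope classical_set_scope.
Local Open Scope ring_scope.

(** * Occurrences of a word in a sequence and in its powers *)

Section WordOccurrences.
Local Open Scope nat_scope.
Context {T : eqType}.
Implicit Types (w s t c : seq T) (b : T).

(** The body of [occ] on plain sequences, so that inductions may leave the set of reduced words. *)
Definition occs w s : nat :=
  count (fun i => prefix w (drop i s)) (iota 0 (size s).+1).

(** A cyclic occurrence is indexed by its start in the first copy of [c]; two copies leave room to
    read around the cycle when [size w <= size c]. *)
Definition cyc_occs w c : nat :=
  count (fun i => prefix w (drop i (c ++ c))) (iota 0 (size c)).

Definition word_pow c n : seq T := flatten (nseq n c).

Lemma word_powS c n : word_pow c n.+1 = c ++ word_pow c n.
Proof. by []. Qed.

Lemma word_powSr c n : word_pow c n.+1 = word_pow c n ++ c.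
Proof. 
elim: n => [|n IHn]; first by rewrite word_powS cats0.
by rewrite word_powS {1}IHn catA.
Qed.

Lemma word_pow0 n : word_pow [::] n = [::].
Proof. by elim: n. Qed.

Lemma sub_in_count (P Q : pred nat) (r : seq nat) :
  {in r, forall i, P i -> Q i} -> count P r <= count Q r.
Proof.
move=> PQ; rewrite (@eq_in_count _ P (predI P Q)).
  by apply: sub_count => i /andP[].
by move=> i ir /=; case Pi: (P i) => //=; rewrite PQ.
Qed.

Lemma drop_catD s t n : drop (size s + n) (s ++ t) = drop n t.
Proof. by rewrite addnC -drop_drop drop_size_cat. Qed.

Lemma drop_cat_le s t n : n <= size s -> drop n (s ++ t) = drop n s ++ t.
Proof.
rewrite leq_eqVlt => /predU1P[->|ns]; last by rewrite drop_cat ns.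
by rewrite drop_size_cat // drop_size.
Qed.

Lemma occs_cat w s t :
  occs w (s ++ t) =
  count (fun i => prefix w (drop i (s ++ t))) (iota 0 (size s)) + occs w t.
Proof.
rewrite /occs size_cat -addnS iotaD count_cat add0n; congr (_ + _).
rewrite -[X in iota X]addn0 iotaDl count_map.
by apply: eq_count => i /=; rewrite drop_catD.
Qed.

Lemma occs_cons w b s : occs w (b :: s) = prefix w (b :: s) + occs w s.
Proof. by rewrite -cat1s occs_cat /= addn0. Qed.

Lemma prefix_drop_cat w s t i : i + size w <= size s ->
  prefix w (drop i (s ++ t)) = prefix w (drop i s).
Proof.
move=> iws; have si : i <= size s by lia.
by rewrite !prefixE drop_cat_le // takel_cat // size_drop; lia.
Qed.

Lemma prefix_drop_size w s i : prefix w (drop i s) -> i <= size s ->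
  i + size w <= size s.
Proof. by move=> /size_prefix; rewrite size_drop; lia. Qed.

Lemma occs_large w s : size s < size w -> occs w s = 0.
Proof.
move=> sw; apply/eqP; rewrite -leqn0 leqNgt -has_count; apply/hasPn => i _.
by apply/negP => /size_prefix; rewrite size_drop; lia.
Qed.

Lemma occs_rcons_ge w s b : occs w s <= occs w (rcons s b).
Proof.
rewrite {2}/occs size_rcons -[(size s).+2]addn1 iotaD count_cat.
apply: leq_trans (leq_addr _ _); apply: sub_in_count => i.
rewrite mem_iota /= add0n ltnS => si; rewrite -cats1 => pw.
by rewrite prefix_drop_cat // prefix_drop_size.
Qed.

Lemma occs_rcons_le w s b : occs w (rcons s b) <= occs w s + (size w).+1.
Proof.
(* Below [k] lie exactly the starts at which [w] fits inside [s]; at most [(size w).+1] other starts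
   remain. *)
pose k := (size s).+1 - size w.
have -> : occs w (rcons s b) =
    count (fun i => prefix w (drop i (rcons s b))) (iota 0 k) +
    count (fun i => prefix w (drop i (rcons s b))) (iota k ((size s).+2 - k)).
  by rewrite /occs size_rcons -count_cat -{2}[k]add0n -iotaD; congr count;
     congr iota; rewrite /k; lia.
apply: leq_add; last by rewrite (leq_trans (count_size _ _)) // size_iota; lia.
apply: (@leq_trans (count (fun i => prefix w (drop i s)) (iota 0 k))).
  apply: sub_in_count => i; rewrite mem_iota /= => ik.
  by rewrite -cats1 prefix_drop_cat //; rewrite /k in ik; lia.
rewrite /occs; have -> : (size s).+1 = k + ((size s).+1 - k) by rewrite /k; lia.
by rewrite iotaD count_cat leq_addr.
Qed.

(** From a start in any copy but the last, [w] reaches at most into the next copy, so it is counted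
    cyclically; the last copy stands alone. *)
Lemma occs_word_pow_small w c n : size w <= size c ->
  occs w (word_pow c n.+1) = n * cyc_occs w c + occs w c.
Proof.
move=> wc; elim: n => [|n IHn]; first by rewrite word_powS cats0.
rewrite word_powS occs_cat IHn mulSn addnA; congr (_ + _ + _).
apply: eq_in_count => i; rewrite mem_iota /= => ic.
by rewrite word_powS catA prefix_drop_cat // size_cat; lia.
Qed.

(* A subword of [word_pow c n] longer than [c] has period [size c]. *)
Lemma prefix_drop_period w c n i : size c <= size w ->
  prefix w (drop i (word_pow c n)) -> prefix (drop (size c) w) w.
Proof.
move=> cw pw; case: n pw => [|n] pw.
  by move: pw; rewrite drop_oversize // prefixs0 => /eqP ->.
have [t wt] := prefixP pw.
(* Shift by one period: without its first [size c] letters the occurrence starts at [i + size c],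
   hence at [i] once a leading copy of [c] is deleted; and [word_pow c n] is a prefix of
   [word_pow c n.+1]. *)
have pw' : prefix (drop (size c) w) (drop i (word_pow c n.+1)).
  have : prefix (drop (size c) w) (drop (size c) (drop i (word_pow c n.+1))).
    by rewrite wt drop_cat_le // prefix_prefix.
  rewrite drop_drop addnC -drop_drop word_powS drop_size_cat // -word_powS.
  rewrite word_powSr; case: (leqP i (size (word_pow c n))) => isz.
    by rewrite drop_cat_le // => /prefix_catl; apply.
  rewrite [drop i (word_pow c n)]drop_oversize ?(ltnW isz) // prefixs0.
  move=> /eqP ->.
  exact: prefix0s.
rewrite wt prefixE takel_cat in pw'; last by rewrite size_drop leq_subr.
by rewrite prefixE.
Qed.

Lemma occs_word_pow_eq0 w c n : size c < size w ->
  ~~ prefix (drop (size c) w) w -> occs w (word_pow c n) = 0.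
Proof.
move=> cw npw; apply/eqP; rewrite -leqn0 leqNgt -has_count; apply/hasPn => i _.
by apply: contra npw; apply: prefix_drop_period; exact: ltnW.
Qed.

Lemma cyc_occs_eq0 w c : size c < size w ->
  ~~ prefix (drop (size c) w) w -> cyc_occs w c = 0.
Proof.
move=> cw npw; apply/eqP; rewrite -leqn0 leqNgt -has_count; apply/hasPn => i _.
apply: contra npw.
have -> : c ++ c = word_pow c 2 by rewrite /word_pow /= cats0.
by apply: prefix_drop_period; exact: ltnW.
Qed.

End WordOccurrences.
Arguments word_pow : simpl never.

(** * Cyclic reduction, self-overlaps and the effect of multiplication on counts *)

Section ReducedWords.
Context {X : finType}.
Local Notation F := (freegroup X).
Implicit Types (s t : seq (letter X)) (w g h p q : F).

Lemma reduced_catP s t : reduced (s ++ t) -> reduced s /\ reduced t.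
Proof.
case: s => [|a s] //; rewrite /reduced /= cat_path => /andP[-> st].
by split=> //; exact: path_sorted st.
Qed.

(** Only adjacent letters matter, and as the middle factor is nonempty, each adjacent pair lies in
    one of the two overlapping pieces. *)
Lemma reduced_cat3 s b t u : reduced (s ++ b :: t) -> reduced ((b :: t) ++ u) ->
  reduced (s ++ (b :: t) ++ u).
Proof.
case: s => [|a s] //; rewrite /reduced /= !cat_path /= cat_path.
by move=> /and3P[-> -> _] ->.
Qed.

Lemma wmul_cat s t : reduced (s ++ t) -> wmul s t = s ++ t.
Proof.
elim: s => //= a s IHs rst; rewrite IHs; last exact: path_sorted rst.
by case: (s ++ t) rst => //= b u /andP[/negPf ->].
Qed.

Lemma word_mul g h : word (g * h)%g = wmul g h.
Proof. by []. Qed.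

(** The square tests both [s] and the junction from its last letter back to its first. *)
Definition cyclically_reduced s : bool := reduced (s ++ s).

Lemma reduced_word_pow s n : cyclically_reduced s -> reduced (word_pow s n).
Proof.
case: s => [|b s] rss; first by rewrite word_pow0.
have [rs _] := reduced_catP _ _ rss.
elim: n => [|[|n] IHn] //; first by rewrite word_powS cats0.
by rewrite word_powS word_powS; apply: reduced_cat3.
Qed.

Lemma word_expg g n : cyclically_reduced g -> word (g ^+ n)%g = word_pow g n.
Proof.
move=> cg; elim: n => [|n IHn] //.
rewrite expgS word_mul IHn wmul_cat // -word_powS.
exact: reduced_word_pow.
Qed.

Lemma letter_self b : b != linv b :> letter X.
Proof. by rewrite eq_sym linv_neq. Qed.

(** Induction on length: as long as the last letter is the inverse of the first, the pair is moved
    into the conjugator. *)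
Lemma cyclic_reduction g :
  exists p c, g = (p * c * p^-1)%g /\ cyclically_reduced c.
Proof.
have [n] := ubnP (size g); elim: n g => // n IHn g gn.
case E: (word g) (wordP g) => [|a s] rg.
  by exists 1%g, g; rewrite mul1g invg1 mulg1 /cyclically_reduced E.
elim/last_ind: s E rg => [|t b _] E rg.
  exists 1%g, g; rewrite mul1g invg1 mulg1 /cyclically_reduced E; split=> //.
  by rewrite /reduced /= letter_self.
have [ba|nba] := eqVneq b (linv a); last first.
  exists 1%g, g; rewrite mul1g invg1 mulg1 /cyclically_reduced E; split=> //.
  move: (rg); rewrite /reduced /= cat_path => -> /=; rewrite last_rcons.
  have -> : a != linv b by apply: contraNN nba => /eqP ->; rewrite linvK.
  exact: rg.
have rt : reduced t.
  by move: rg; rewrite -cats1 -cat1s => /reduced_catP[_ /reduced_catP[]].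
have ra : reduced [:: a] by [].
pose u := FreeGroup ra; pose h := FreeGroup rt.
have gE : g = (u * h * u^-1)%g.
  rewrite -mulgA; apply: val_inj.
  rewrite -[RHS]/(lmul a (wmul t [:: linv a])) /= E ba.
  have rab : reduced (t ++ [:: linv a]).
    by move: rg; rewrite -cats1 -cat1s ba => /reduced_catP[].
  rewrite (wmul_cat _ _ rab).
  have := wmul_cat [:: a] (t ++ [:: linv a]) => /= ->.
    by rewrite cats1.
  by rewrite cats1 -ba.
have [|p [c [hE cc]]] := IHn h.
  by move: gn; rewrite E /= size_rcons; lia.
by exists (u * p)%g, c; split=> //; rewrite gE hE invgM !mulgA.
Qed.

(** With period [k], deleting the first [k] letters or the last [k] letters leaves the same word y;
    the deleted pieces are x and z. *)
Lemma self_overlapping_period w k : (0 < k < size w)%N ->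
  prefix (drop k w) w -> self_overlapping w.
Proof.
move=> /andP[k0 kw]; rewrite prefixE size_drop => /eqP yE.
pose m := (size w - k)%N.
have [rx ry] : reduced (take k w) /\ reduced (drop k w).
  by apply: reduced_catP; rewrite cat_take_drop; exact: wordP.
have [_ rz] : reduced (take m w) /\ reduced (drop m w).
  by apply: reduced_catP; rewrite cat_take_drop; exact: wordP.
pose x := FreeGroup rx; pose y := FreeGroup ry; pose z := FreeGroup rz.
have xy : reduced_prod x y.
  by rewrite /reduced_prod word_mul wmul_cat //= cat_take_drop; exact: wordP.
have yz : reduced_prod y z.
  rewrite /reduced_prod word_mul wmul_cat //= -yE cat_take_drop; exact: wordP.
have neq1 (h : F) : (0 < size h)%N -> h <> 1%g by move=> + hE; rewrite hE.
exists x, y, z; split=> //.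
- split; apply: neq1; rewrite /= ?size_take ?size_drop.
  + by rewrite kw.
  + by rewrite subn_gt0.
  + by rewrite subn_gt0 ltn_subrL k0 (leq_ltn_trans _ kw).
- by apply: val_inj; rewrite /= -[LHS](cat_take_drop k) -xy.
- by apply: val_inj; rewrite /= -[LHS](cat_take_drop m) yE -yz.
Qed.

Lemma occ_eq0 w g : (size g < size w)%N -> occ w g = 0%N.
Proof. exact: occs_large. Qed.

Lemma nonoverlapping_period w g : non_self_overlapping w ->
  (size g < size w)%N -> (0 < size g)%N -> ~~ prefix (drop (size g) w) w.
Proof.
move=> Nw gw g0; apply/negP => pw; apply: Nw.
by apply: self_overlapping_period pw; rewrite g0.
Qed.

Lemma nonoverlapping_cyc_occs w g : non_self_overlapping w ->
  (size g < size w)%N -> cyc_occs w g = 0%N.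
Proof.
move=> Nw gw; case: (posnP (size g)) => [/size0nil ->|g0] //.
by apply: cyc_occs_eq0 => //; exact: nonoverlapping_period.
Qed.

Lemma occ_expg w g n : cyclically_reduced g -> non_self_overlapping w ->
  occ w (g ^+ n.+1)%g = (n * cyc_occs w g + occ w g)%N.
Proof.
move=> cg Nw; rewrite -!/(occs _ _) [LHS]/occ word_expg //.
have [wg|gw] := leqP (size w) (size g); first exact: occs_word_pow_small.
rewrite nonoverlapping_cyc_occs // muln0 (occ_eq0 _ _ gw).
(* Period 0 gives no overlap, so the empty [g] is treated apart: its powers are empty while [w] is
   not. *)
case: (posnP (size g)) => [/size0nil|] g0.
  by rewrite g0 word_pow0; apply: occs_large; rewrite -g0.
by apply: occs_word_pow_eq0 => //; exact: nonoverlapping_period.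
Qed.

(** Distance at most [K], written without truncated subtraction. *)
Definition nat_close (K m n : nat) : bool := (m <= n + K)%N && (n <= m + K)%N.

Lemma nat_close_trans K L l m n :
  nat_close K l m -> nat_close L m n -> nat_close (K + L) l n.
Proof. by rewrite /nat_close; lia. Qed.

(** A letter multiplied on the left adds or cancels one first letter, which affects only an
    occurrence starting there. *)
Lemma occs_wmul_left (v s t : seq (letter X)) :
  nat_close (size s) (occs v (wmul s t)) (occs v t).
Proof.
elim: s => [|a s IHs]; first by rewrite /nat_close /=; lia.
rewrite -[size _]add1n /=; apply: nat_close_trans IHs.
case: (wmul s t) => [|b u] /=; last case: ifP => _.
all: by rewrite /nat_close ?occs_cons; case: prefix; lia.
Qed.

Lemma occs_wmul_letter (v s : seq (letter X)) b : reduced s ->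
  nat_close (size v).+1 (occs v (wmul s [:: b])) (occs v s).
Proof.
elim/last_ind: s => [|s a _] rs.
  rewrite /nat_close (occs_rcons_le v [::] b).
  exact: leq_trans (occs_rcons_ge v [::] b) (leq_addr _ _).
have [ba|nba] := eqVneq b (linv a).
  have -> : wmul (rcons s a) [:: b] = s.
    rewrite /wmul foldr_rcons /= ba eqxx -/(wmul s [::]) wmuls0 //.
    by move: rs; rewrite -cats1 => /reduced_catP[].
  rewrite /nat_close andbC occs_rcons_le /=.
  by rewrite (leq_trans (occs_rcons_ge _ _ a)) // leq_addr.
rewrite wmul_cat ?cats1.
  rewrite /nat_close occs_rcons_le.
  by rewrite (leq_trans (occs_rcons_ge _ _ b)) // leq_addr.
move: rs; rewrite /reduced; case: s => [|c s] /=; first by rewrite nba.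
by rewrite !rcons_path last_rcons => ->.
Qed.

(** Since [wmul] recurses on its left factor, associativity is used to move the letters of [t] one
    by one to the end of [s]. *)
Lemma occs_wmul_right (v s t : seq (letter X)) : reduced s -> reduced t ->
  nat_close (size t * (size v).+1) (occs v (wmul s t)) (occs v s).
Proof.
elim: t s => [|b t IHt] s rs rt; first by rewrite wmuls0 // /nat_close; lia.
have rt' : reduced t by exact: path_sorted rt.
have -> : wmul s (b :: t) = wmul (wmul s [:: b]) t.
  by rewrite -wmulA // (wmul_cat [:: b] t).
rewrite /= mulSn addnC; apply: nat_close_trans (IHt _ _ rt') _.
  exact: reduced_wmul.
exact: occs_wmul_letter.
Qed.

Lemma occ_mul_bounded w p q :
  exists K, forall g, nat_close K (occ w (p * g * q)%g) (occ w g).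
Proof.
exists (size q * (size w).+1 + size p)%N => g.
apply: (@nat_close_trans _ _ _ (occ w (p * g)%g)).
  by apply: occs_wmul_right; exact: wordP.
exact: occs_wmul_left.
Qed.

Lemma size_invg g : size (g^-1)%g = size g.
Proof. by rewrite /= size_rev size_map. Qed.

Lemma finite_words m : finite_set [set w : F | (size w <= m)%N].
Proof.
(* Words come from tuples of length at most [m] over the finite alphabet; a tuple that is not
   reduced is sent to the default 1. *)
pose f (t : {k : 'I_m.+1 & k.-tuple (letter X)}) : F :=
  insubd (1%g : F) (val (tagged t)).
apply: (@sub_finite_set _ _ (f @` setT)); last first.
  by apply: finite_image; exact: finite_finset.
move=> w /= wm; pose k : 'I_m.+1 := Ordinal (wm : (size w < m.+1)%N).
exists (Tagged (fun k : 'I_m.+1 => k.-tuple (letter X))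
               (in_tuple w : k.-tuple _)) => //.
by apply: val_inj; rewrite /f /= insubdK //; exact: wordP.
Qed.

End ReducedWords.

(** * Homogenization of quasimorphisms and bounded distance *)

Section Homogenization.
Context {R : realType} {G : groupType}.
Implicit Types (phi : G -> R) (g p c : G).

Lemma homogenizationE phi g (L K : R) :
  (forall n, `|phi (g ^+ n.+1)%g - n%:R * L| <= K) -> homogenization phi g = L.
Proof.
move=> H; apply: cvg_lim => //; rewrite -cvg_shiftS.
apply/subr_cvg0/norm_cvg0P.
(* The extra [|L|] pays for comparing with [n * L] at the power [n.+1]. *)
have h0 : (fun n => (K + `|L|) * harmonic n) @ \oo --> (0 : R).
  rewrite -[X in _ --> X](mulr0 (K + `|L|)).
  by apply: cvgMr; exact: cvg_harmonic.
apply: (squeeze_cvgr _ (cvg_cst 0) h0); apply: nearW => n.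
rewrite normr_ge0 /= /harmonic /=.
have n0 : (n.+1)%:R != 0 :> R by rewrite pnatr_eq0.
have -> : phi (g ^+ n.+1)%g / n.+1%:R - L =
    ((phi (g ^+ n.+1)%g - n%:R * L) - L) / n.+1%:R.
  by rewrite [n.+1%:R]mulrSr in n0 *; field.
rewrite normrM normfV (ger0_norm (ler0n _ _)) ler_wpM2r ?invr_ge0 //.
by rewrite (le_trans (ler_normB _ _)) // lerD.
Qed.

Lemma homogenization_conj phi p c (L C K : R) :
  (forall n, phi (c ^+ n.+1)%g = n%:R * L + C) ->
  (forall g, `|phi (p * g * p^-1)%g - phi g| <= K) ->
  homogenization phi (p * c * p^-1)%g = L.
Proof.
move=> cE pE; apply: (@homogenizationE _ _ _ (K + `|C|)) => n.
have -> : ((p * c * p^-1) ^+ n.+1 = p * c ^+ n.+1 * p^-1)%g.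
  by have := conjXg c p^-1%g n.+1; rewrite !conjgE invgK !mulgA => <-.
have -> : phi (p * c ^+ n.+1 * p^-1)%g - n%:R * L =
    (phi (p * c ^+ n.+1 * p^-1)%g - phi (c ^+ n.+1)%g) + C by rewrite cE; ring.
by rewrite (le_trans (ler_normD _ _)) // lerD.
Qed.

Lemma quasimorphism_mul_bounded phi p q : quasimorphism phi ->
  exists K, forall g, `|phi (p * g * q)%g - phi g| <= K.
Proof.
(* Splitting off [p] and then [q] costs one defect each, plus the values at [p] and [q]. *)
move=> [D hD]; exists (D + D + `|phi p| + `|phi q|) => g.
have := hD p g; have := hD (p * g)%g q.
rewrite !ler_norml => /andP[h1 h2] /andP[h3 h4].
have := ler_norm (phi p); have := ler_norm (phi q).
have := ler_norm (- phi p); have := ler_norm (- phi q); rewrite !normrN.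
by move=> *; apply/andP; split; lra.
Qed.

(** Dividing the bound of [quasimorphism_expg] for powers of [g] by the exponent gives [D]
    uniformly, and this survives the limit. *)
Lemma homogenization_dist phi : quasimorphism phi ->
  exists D, forall g, `|homogenization phi g - phi g| <= D.
Proof.
move=> qphi; have [D hD] := qphi; exists D => g.
have cv : (fun n => phi (g ^+ n.+1)%g / n.+1%:R) @ \oo --> homogenization phi g.
  rewrite (cvg_shiftS (fun n => phi (g ^+ n)%g / n%:R)).
  exact: is_cvg_homogenization.
have cv' : `|phi (g ^+ n.+1)%g / n.+1%:R - phi g| @[n --> \oo] -->
    `|homogenization phi g - phi g|.
  by apply: cvg_norm; apply: cvgB cv _; exact: cvg_cst.
apply: (cvgr_to_le cv'); apply: nearW => n /=.
have n0 : 0 < n.+1%:R :> R by rewrite ltr0n.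
have := quasimorphism_expg g 1 n hD; rewrite mul1n expg1 => H.
have -> : phi (g ^+ n.+1)%g / n.+1%:R - phi g =
    (phi (g ^+ n.+1)%g - n.+1%:R * phi g) / n.+1%:R.
  by rewrite mulrBl [_ * phi g]mulrC mulfK // gt_eqF.
by rewrite normrM normfV (gtr0_norm n0) ler_pdivrMr // [D * _]mulrC.
Qed.

Lemma quasimorphism_homogenization phi : quasimorphism phi ->
  quasimorphism (homogenization phi).
Proof.
move=> qphi; have [D hD] := qphi; have [E hE] := homogenization_dist _ qphi.
exists (D + E + E + E) => g h.
have := hD g h; have := hE g; have := hE h; have := hE (g * h)%g.
rewrite !ler_norml => /andP[? ?] /andP[? ?] /andP[? ?] /andP[? ?].
by apply/andP; split; lra.
Qed.

End Homogenization.

(** * Counting quasimorphisms on powers, and linearity of sums over words *)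

Section Sums.
Context {R : realType} {X : finType}.
Local Notation F := (freegroup X).
Implicit Types (w g c p : F) (alpha : F -> R).

(** The number C_w(c) of the overview. *)
Definition cyc_counting w c : R :=
  (cyc_occs w c)%:R - (cyc_occs (w^-1)%g c)%:R.

Lemma counting_qm_mul_bounded w p q :
  exists K, forall g, `|counting_qm R w (p * g * q)%g - counting_qm R w g| <= K.
Proof.
have [K hK] := occ_mul_bounded w p q.
have [L hL] := occ_mul_bounded (w^-1)%g p q.
exists (K%:R + L%:R) => g; rewrite /counting_qm.
move: (hK g) (hL g); rewrite /nat_close -!(ler_nat R) !natrD.
move=> /andP[? ?] /andP[? ?]; rewrite ler_norml; apply/andP; split; lra.
Qed.

Lemma counting_qm_expg w c n : cyclically_reduced c ->
  non_self_overlapping w -> non_self_overlapping (w^-1)%g ->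
  counting_qm R w (c ^+ n.+1)%g = n%:R * cyc_counting w c + counting_qm R w c.
Proof.
move=> cc Nw Nw'; rewrite /counting_qm /cyc_counting !occ_expg //.
by rewrite !natrD !natrM; ring.
Qed.

Lemma homogenization_counting_qm w p c : cyclically_reduced c ->
  non_self_overlapping w -> non_self_overlapping (w^-1)%g ->
  homogenization (counting_qm R w) (p * c * p^-1)%g = cyc_counting w c.
Proof.
move=> cc Nw Nw'; have [K hK] := counting_qm_mul_bounded w p (p^-1)%g.
apply: homogenization_conj hK => n; exact: counting_qm_expg.
Qed.

Lemma fsum_words (P : set F) (m : nat) (f : F -> R) :
  (forall w, (m < size w)%N -> f w = 0) ->
  \sum_(w \in P) f w = \sum_(w \in P `&` [set w : F | (size w <= m)%N]) f w.
Proof.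
move=> f0; apply/esym/fsbig_widen => // w [Pw nw]; apply: f0.
by rewrite ltnNge; apply/negP => wm; apply: nw.
Qed.

(** A sum over an infinite set defaults to 0 when its support is infinite, so linearity is not
    automatic; the length bound places all three sums over one finite set. *)
Lemma fsum_words_linear (P : set F) (m : nat) (a : R) (f g : F -> R) :
  (forall w, (m < size w)%N -> f w = 0) ->
  (forall w, (m < size w)%N -> g w = 0) ->
  \sum_(w \in P) (a * f w + g w) =
  a * \sum_(w \in P) f w + \sum_(w \in P) g w.
Proof.
move=> f0 g0; have fin : finite_set (P `&` [set w : F | (size w <= m)%N]).
  by apply: finite_setIr; exact: finite_words.
rewrite (fsum_words P m f) // (fsum_words P m g) //.
rewrite (fsum_words P m (fun w => a * f w + g w)) => [|w mw].
  by rewrite !fsbig_finite // big_split mulr_sumr.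
by rewrite f0 // g0 // mulr0 addr0.
Qed.

End Sums.

Theorem proposition1p10 (R : realType) (X : finType)
    (nonabelian : exists g h : freegroup X, (g * h)%g <> (h * g)%g)
    (Np : set (freegroup X)) (hNp : positive_half Np)
    (alpha : freegroup X -> R) (halt : alternating alpha)
    (hsupp : supported_on (@non_self_overlapping X) alpha) :
  quasimorphism (phi_sum Np alpha) ->
  quasimorphism (phi_tilde Np alpha) /\
  homogenization (phi_sum Np alpha) = phi_tilde Np alpha.
Proof.
move=> qphi.
suff E : homogenization (phi_sum Np alpha) = phi_tilde Np alpha.
  by rewrite -E; split=> //; exact: quasimorphism_homogenization.
(* Inverses of words in the support are again in the support, so the power formula applies to both
   counts in each nonzero term. *)
have N w : alpha w != 0 ->
    non_self_overlapping w /\ non_self_overlapping (w^-1)%g.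
  move=> /eqP a0; split; apply: hsupp => //.
  by rewrite halt => /eqP; rewrite oppr_eq0 => /eqP.
apply/funext => g; have [p [c [-> cc]]] := cyclic_reduction g.
(* The hypothesis on the whole sum gives one bound for conjugation by [p]; the bounds for the
   separate [counting_qm w] depend on [w] and are not summed. *)
have [K hK] := quasimorphism_mul_bounded _ p (p^-1)%g qphi.
have tE : phi_tilde Np alpha (p * c * p^-1)%g =
    \sum_(w \in Np) alpha w * cyc_counting w c.
  apply: eq_fsbigr => w _; have [->|/N[Nw Nw']] := eqVneq (alpha w) 0.
    by rewrite !mul0r.
  by rewrite homogenization_counting_qm.
rewrite tE.
(* It remains to show that the sum is exactly affine in [n] on the powers of [c]. *)
apply: (homogenization_conj _ _ _ _ (phi_sum Np alpha c) _ _ hK) => n.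
(* The cutoff [size c] does not depend on [n]: longer words contribute to no power of [c]. *)
have c0 (w : freegroup X) : (size c < size w)%N ->
    alpha w * cyc_counting w c = 0.
  move=> cw; have [->|/N[Nw Nw']] := eqVneq (alpha w) 0; first by rewrite mul0r.
  by rewrite /cyc_counting !nonoverlapping_cyc_occs ?size_invg // subrr mulr0.
have o0 (w : freegroup X) : (size c < size w)%N ->
    alpha w * counting_qm R w c = 0.
  by move=> cw; rewrite /counting_qm !occ_eq0 ?size_invg // subrr mulr0.
have sE : phi_sum Np alpha (c ^+ n.+1)%g =
    \sum_(w \in Np) (n%:R * (alpha w * cyc_counting w c) +
                     alpha w * counting_qm R w c).
  apply: eq_fsbigr => w _; have [->|/N[Nw Nw']] := eqVneq (alpha w) 0.
    by rewrite !mul0r mulr0 addr0.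
  by rewrite counting_qm_expg //; ring.
by rewrite sE (fsum_words_linear _ (size c)).
Qed.
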